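(* Let $\beta\ge 1$. Assume that there is $u^\dagger\in\mathrm{dom}(J)$ with $Au^\dagger=f$ and that there is $q\in\mathcal H$ with $A^*q\in\partial J(u^\dagger)$. Let $$s_*:=\inf\{\|q\|_{\mathcal H}: q\in\mathcal H,\ A^*q\in\partial J(u)\text{ for some }u\in\mathrm{dom}(J)\text{ with }Au=f\},$$ $$J_{\min}:=\min\{J(u):u\in\mathcal X,\ Au=f\},\qquad t_*:=\frac{J_{\min}^{1-\beta}}{s_*}.$$ Then for every $0<t<t_*$, every minimizer $u_t$ of $E_t^{1,\beta}(\cdot;f)$ fulfills $Au_t=f$.
   Context: Setting: $\mathcal X$ is the (real) Banach space dual of a separable Banach space $\mathcal Y$; $\mathcal H$ is a real Hilbert space; $A:\mathcal X\to\mathcal H$ is bounded and linear, with adjoint $A^*:\mathcal H\to\mathcal X^*$, $\langle A^*q,u\rangle=\langle q,Au\rangle$. $J:\mathcal X\to[0,\infty]$ is convex, proper, weak$^*$ lower semi-continuous and absolutely one-homogeneous ($J(cu)=|c|J(u)$). $\mathcal N(J)=\{u:J(u)=0\}$, $\mathrm{dom}(J)=\{u:J(u)<\infty\}$, and $\partial J(u)=\{p\in\mathcal X^*: J(u)+\langle p,v-u\rangle\le J(v)\ \forall v\in\mathcal X\}$. The datum $f\in\mathcal H$ is such that any $u\in\mathcal X$ with $Au=f$ satisfies $J(u)\ne 0$. For $\alpha,\beta\ge1$, $t>0$: $E_t^{\alpha,\beta}(u;f)=\frac1\alpha\|Au-f\|_{\mathcal H}^\alpha+\frac t\beta J(u)^\beta$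 for $u\in\mathcal X$. Standing assumptions: (1) $u\mapsto\|Au\|_{\mathcal H}$ is a norm on $\mathcal N(J)$ equivalent to the restriction of $\|\cdot\|_{\mathcal X}$. (2) There is $C>0$ with $\|u-\mathcal P^A(Au)\|_{\mathcal X}\le C J(u)$ for all $u\in\mathcal X$, where $\mathcal P^A(g)$ denotes the (unique) minimizer of $\|Au-g\|_{\mathcal H}$ over $u\in\mathcal N(J)$, $g\in\mathcal H$. (3) $A$ is weak$^*$-to-weak continuous: $u_k\rightharpoonup^* u$ in $\mathcal X$ implies $Au_k\rightharpoonup Au$ in $\mathcal H$. Under the hypotheses on $f$, one has $0<s_*<\infty$ and $J_{\min}>0$. *)

(* Defs.v *)
From HB Require Import structures.
From mathcomp Require Import all_boot all_order all_algebra.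
From mathcomp Require Import all_classical all_reals all_analysis.
Set Implicit Arguments.
Unset Strict Implicit.
Unset Printing Implicit Defensive.
Import Order.TTheory GRing.Theory Num.Theory.
Import numFieldNormedType.Exports.
Local Open Scope classical_set_scope.
Local Open Scope ring_scope.

Definition bounded_linear (R : realType) (V W : normedModType R) :
    {pred V -> W} :=
  fun g => `[< linear g /\ continuous g >].

Record bounded_operator (R : realType) (V W : normedModType R) :=
  BoundedOperator {
  bounded_operator_fun :> V -> W ;
  bounded_operatorP : bounded_operator_fun \in @bounded_linear R V W }.

HB.instance Definition _ (R : realType) (V W : normedModType R) :=
  [isSub for @bounded_operator_fun R V W].
HB.instance Definition _ (R : realType) (V W : normedModType R) :=
  [Choice of bounded_operator V W by <:].

Lemma bounded_linear_submod (R : realType) (V W : normedModType R) :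
  submod_closed (@bounded_linear R V W).
Proof.
split.
  apply/asboolP; split; first by move=> a x y; rewrite /= scaler0 addr0.
  exact: (@cst_continuous V W 0).
move=> a u v /asboolP[ul uc] /asboolP[vl vc]; apply/asboolP; split.
  move=> k x y; rewrite -[LHS]/(a *: u (k *: x + y) + v (k *: x + y)).
  rewrite -[RHS]/(k *: (a *: u x + v x) + (a *: u y + v y)).
  by rewrite ul vl !scalerDr !scalerA (mulrC a) addrACA.
by move=> x; apply: cvgD; [apply: cvgZr; exact: uc|exact: vc].
Qed.

HB.instance Definition _ (R : realType) (V W : normedModType R) :=
  GRing.isSubmodClosed.Build R (V -> W) (@bounded_linear R V W)
    (@bounded_linear_submod R V W).
HB.instance Definition _ (R : realType) (V W : normedModType R) :=
  [SubChoice_isSubLmodule of bounded_operator V W by <:].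

Section operator_linear.
Context (R : realType) (V W : normedModType R) (g : bounded_operator V W).

Lemma bounded_operator_linear : linear g.
Proof. by case: g => h /= /asboolP[]. Qed.

HB.instance Definition _ :=
  GRing.isLinear.Build R V W *:%R (bounded_operator_fun g)
    bounded_operator_linear.

Lemma bounded_operator_continuous : continuous g.
Proof. by case: g => h /= /asboolP[]. Qed.

End operator_linear.

Definition operator_norm (R : realType) (V W : normedModType R)
    (g : bounded_operator V W) : R :=
  sup [set `|g x| | x in [set x | `|x| <= 1]].

Section operator_norm.
Context (R : realType) (V W : normedModType R).
Implicit Types g h : bounded_operator V W.

Lemma operator_norm_has_sup g :
  has_sup [set `|g x| | x in [set x : V | `|x| <= 1]].
Proof.
split; first by exists `|g 0|, 0 => //=; rewrite normr0.
have : bounded_near g (nbhs (0 : V)).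
  by apply/linear_bounded_continuous; exact: bounded_operator_continuous.
move=> /linear_boundedP/pinfty_ex_gt0[M M0 gM].
by exists M => _ [x /= x1 <-]; rewrite (le_trans (gM x))// ler_piMr// ltW.
Qed.

Lemma operator_norm_ub g x : `|x| <= 1 -> `|g x| <= operator_norm g.
Proof.
by move=> x1; apply: ub_le_sup; [case: (operator_norm_has_sup g)|exists x].
Qed.

Lemma operator_norm_le g (M : R) :
  (forall x, `|x| <= 1 -> `|g x| <= M) -> operator_norm g <= M.
Proof.
move=> gM; apply: ge_sup; first by case: (operator_norm_has_sup g).
by move=> _ [x /= x1 <-]; exact: gM.
Qed.

Lemma operator_norm_ge0 g : 0 <= operator_norm g.
Proof. by rewrite (le_trans _ (operator_norm_ub g (x := 0) _))// normr0. Qed.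

Lemma operator_normD g h :
  operator_norm (g + h) <= operator_norm g + operator_norm h.
Proof.
apply: operator_norm_le => x x1; rewrite (le_trans (ler_normD _ _))//.
by rewrite lerD// operator_norm_ub.
Qed.

Lemma operator_normZ (a : R) g : operator_norm (a *: g) = `|a| * operator_norm g.
Proof.
apply/eqP; rewrite eq_le; apply/andP; split.
  apply: operator_norm_le => x x1; rewrite [X in `|X|](_ : _ = a *: g x)//.
  by rewrite normrZ ler_wpM2l// operator_norm_ub.
have [->|a0] := eqVneq a 0; first by rewrite normr0 mul0r operator_norm_ge0.
rewrite -ler_pdivlMl ?normr_gt0//; apply: operator_norm_le => x x1.
rewrite ler_pdivlMl ?normr_gt0// -normrZ.
exact: (@operator_norm_ub (a *: g)).
Qed.

Lemma operator_norm_eq0 g : operator_norm g = 0 -> g = 0.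
Proof.
move=> g0; apply/val_inj/funext => x /=.
have [->|x0] := eqVneq x 0; first by rewrite linear0.
have := @operator_norm_ub g (`|x|^-1 *: x).
rewrite normrZ normfV normr_id mulVf ?normr_eq0// g0 => /(_ (lexx _)).
rewrite normr_le0 linearZ/= scaler_eq0 invr_eq0 normr_eq0 (negbTE x0)/=.
by move/eqP.
Qed.

HB.instance Definition _ := @Lmodule_isNormed.Build R (bounded_operator V W)
  (@operator_norm R V W) operator_normD operator_normZ operator_norm_eq0.

End operator_norm.

Definition dual (R : realType) (V : normedModType R) : Type :=
  bounded_operator V R^o.
HB.instance Definition _ (R : realType) (V : normedModType R) :=
  NormedModule.on (dual V).

(* The coarsest topology making all evaluations p |-> p y continuous; the type
   is that of [dual Y], whose own topology is the norm topology. *)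
Definition weak_star (R : realType) (Y : normedModType R) : Type :=
  initial_topology (fun (p : dual Y) => (p : Y -> R^o) : {ptws Y -> R^o}).
HB.instance Definition _ (R : realType) (Y : normedModType R) :=
  Topological.on (weak_star Y).

Definition weak (R : realType) (V : normedModType R) : Type :=
  initial_topology (fun v : V => (fun p : dual V => p v) : {ptws dual V -> R^o}).
HB.instance Definition _ (R : realType) (V : normedModType R) :=
  Topological.on (weak V).

Definition weak_star_cvg (R : realType) (Y : normedModType R)
    (u_ : nat -> weak_star Y) (u : weak_star Y) : Prop := u_ @ \oo --> u.

Definition weak_cvg (R : realType) (V : normedModType R)
    (v_ : nat -> weak V) (v : weak V) : Prop := v_ @ \oo --> v.

Definition weak_star_lsc (R : realType) (Y : normedModType R)
    (F : weak_star Y -> \bar R) : Prop := lower_semicontinuous F.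

Definition separable (T : topologicalType) : Prop :=
  exists2 D : set T, countable D & dense D.

HB.mixin Record Normed_isHilbert (R : realType) H of CompleteNormedModule R H := {
  inner : {dot H for idfun} ;
  inner_normE : forall x : H, `|x| ^+ 2 = (inner : H -> H -> R) x x }.
#[short(type="hilbertType")]
HB.structure Definition Hilbert (R : realType) :=
  {H of CompleteNormedModule R H & Normed_isHilbert R H}.

Section adjoint.
Context (R : realType) (X : normedModType R) (H : hilbertType R).
Local Notation "''[' x , y ]" := ((@inner R H : H -> H -> R) x y).

Lemma inner_sym (x y : H) : '[x, y] = '[y, x].
Proof. by rewrite hermC expr0 mul1r. Qed.

Lemma inner_cauchy_schwarz (x y : H) : `|'[x, y]| <= `|x| * `|y|.
Proof.
have [->|y0] := eqVneq y 0; first by rewrite linear0r !normr0 mulr0.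
have yy : 0 < '[y, y] by rewrite -inner_normE exprn_gt0// normr_gt0.
rewrite -(@ler_pXn2r _ 2) ?nnegrE ?mulr_ge0// exprMn !inner_normE.
have : 0 <= `|x - ('[x, y] / '[y, y]) *: y| ^+ 2 by rewrite exprn_ge0.
rewrite inner_normE linearBl !linearBr /= !linearZl_LR !linearZr_LR /=.
rewrite (inner_sym y x) real_normK ?num_real// /GRing.scale/=.
rewrite [_^-1 * '[y, y]]mulVf ?gt_eqF// mulr1 (mulrC _^-1) subrr subr0.
by rewrite subr_ge0 mulrAC ler_pdivrMr// -expr2.
Qed.

Lemma adjoint_subproof (A : bounded_operator X H) (q : H) :
  ((fun u => '[q, A u]) : X -> R^o) \in @bounded_linear R X R^o.
Proof.
have lin : linear ((fun u => '[q, A u]) : X -> R^o).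
  by move=> a u v; rewrite linearP linearDr linearZr.
apply/asboolP; split=> // x.
pose L := GRing.isLinear.Build R X R^o *:%R _ lin.
pose l : {linear X -> R^o} := HB.pack (fun u : X => '[q, A u] : R^o) L.
apply: (@bounded_linear_continuous _ _ _ l).
have : bounded_near A (nbhs (0 : X)).
  by apply/linear_bounded_continuous; exact: bounded_operator_continuous.
move=> /linear_boundedP/pinfty_ex_gt0[M M0 AM].
apply/linear_boundedP; near=> r => u.
rewrite (le_trans (inner_cauchy_schwarz _ _))//.
rewrite (le_trans (ler_wpM2l _ (AM u)))// mulrA ler_wpM2r//.
Unshelve. all: by end_near. Qed.

Definition adjoint (A : bounded_operator X H) (q : H) : dual X :=
  BoundedOperator (adjoint_subproof A q).

End adjoint.

(* [P] may be [R] or [\bar R]. *)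
Definition minimizers (T : Type) (d : Order.disp_t) (P : porderType d)
    (D : set T) (F : T -> P) : set T :=
  [set u | D u /\ forall v, D v -> (F u <= F v)%O].

Section functionals.
Context (R : realType) (X : normedModType R).
Implicit Types J : X -> \bar R.

Definition dom J : set X := [set u | (J u < +oo)%E].

Definition null_space J : set X := [set u | J u = 0%E].

(* In [\bar R], 0 * +oo = 0, so this is trivial for l = 0 and l = 1, and
   [absolutely_one_homogeneous] contains J 0 = 0. *)
Definition convex_efun J :=
  forall (u v : X) (l : R), 0 <= l <= 1 ->
    (J (l *: u + (1 - l) *: v)%R <= l%:E * J u + (1 - l)%:E * J v)%E.

Definition absolutely_one_homogeneous J :=
  forall (c : R) (u : X), J (c *: u) = (`|c|%:E * J u)%E.

Definition subdifferential J (u : X) : set (dual X) :=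
  [set p | forall v : X, (J u + (p (v - u)%R)%:E <= J v)%E].

Definition norm_on (N : set X) (n : X -> R) :=
  [/\ forall u, N u -> n u = 0 -> u = 0,
      forall (c : R) u, N u -> n (c *: u) = `|c| * n u &
      forall u v, N u -> N v -> n (u + v) <= n u + n v].

Definition equivalent_on (N : set X) (n m : X -> R) :=
  exists c C : R, [/\ 0 < c, 0 < C &
    forall u, N u -> c * m u <= n u /\ n u <= C * m u].

End functionals.

Section regularization.
Context (R : realType) (X : normedModType R) (H : hilbertType R).
Variables (A : bounded_operator X H) (J : X -> \bar R).

(* [get] selects an element of the set; here the minimizer exists and is unique
   because u |-> `|A u| is equivalent to the norm on the null space of J. *)
Definition null_projection (g : H) : X :=
  get (minimizers (null_space J) (fun u => `|A u - g|)).

Definition energy (alpha beta t : R) (f : H) (u : X) : \bar R :=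
  ((alpha^-1 * `|A u - f| `^ alpha)%:E + (t / beta)%:E * J u `^ beta)%E.

Definition s_star (f : H) : R :=
  inf [set `|q| | q in [set q : H | exists u,
    [/\ dom J u, A u = f & subdifferential J u (adjoint A q)]]].

(* The minimum of J over A u = f, i.e. the value of J at any minimizer. Under the
   source condition a minimizer exists and the value is finite. *)
Definition J_min (f : H) : \bar R :=
  J (get (minimizers [set u | A u = f] J)).

Definition t_star (beta : R) (f : H) : R :=
  fine (J_min f) `^ (1 - beta) / s_star f.

End regularization.

(* Main.v *)
Require Import Defs.
From HB Require Import structures.
From mathcomp Require Import all_boot all_order all_algebra.
From mathcomp Require Import all_classical all_reals all_analysis.
From mathcomp Require Import ring lra.
Set Implicit Arguments.
Unset Strict Implicit.
Unset Printing Implicit Defensive.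
Import Order.TTheory GRing.Theory Num.Theory.
Import numFieldNormedType.Exports.
Local Open Scope classical_set_scope.
Local Open Scope ring_scope.

(** With a norm to the first power as data term, the energy is an exact
    penalty for the constraint A u = f, and t_star is the penalization
    threshold.

    Let A^* q be a subgradient of J at a point w with A w = f, and put
    j := J w.  One-homogeneity of J splits the subgradient inequality into
    j = <q, f> and <q, A v> <= J v for every v
    ([homogeneous_subgradient_eq], [homogeneous_subgradient_le]).  Together they
    give

      J v >= j + <q, A v - f> >= j - |q| |A v - f|     for every v,

    that is, J can drop below its constrained minimum only at a rate at most
    |q| in the residual.  The tangent of x |-> x^beta at j
    ([powR_ge_tangent]) carries this bound over to the penalty:

      J v ^ beta / beta >= j ^ beta / beta - j ^ (beta - 1) |q| |A v - f|.

    Consequently, if t j ^ (beta - 1) |q| < 1, then any v with A v <> f has an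
    energy strictly above t j ^ beta / beta, which is the energy of w
    ([exact_penalization]).  Finally, t < t_star means
    t j ^ (beta - 1) s_star < 1, so some admissible q satisfies the condition,
    by definition of s_star as an infimum; the corresponding j is J_min
    whatever the q selected ([source_J_min]). *)

(** For [1 < b] this is Young's inequality for [a] and [c `^ (b - 1)]: the
    conjugate exponent is b / (b - 1), which turns the second factor into
    [c `^ b]. *)
Lemma powR_ge_tangent (R : realType) (b a c : R) : 1 <= b -> 0 <= a -> 0 < c ->
  c `^ b + b * c `^ (b - 1) * (a - c) <= a `^ b.
Proof.
move=> b1 a0 c0; have b0 : 0 < b by lra.
have cb : c * c `^ (b - 1) = c `^ b by rewrite mulr_powRB1// ltW.
move: b1; rewrite le_eqVlt => /predU1P[b1|b1].
  by rewrite -b1 subrr powRr0 !powRr1 ?(ltW c0)// !mul1r subrKC.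
have bn0 : b != 0 by lra.
have b1n0 : b - 1 != 0 by lra.
have q0 : 0 < b / (b - 1) by rewrite divr_gt0// subr_gt0.
have pq : b^-1 + (b / (b - 1))^-1 = 1 by field; rewrite bn0 b1n0.
have := conjugate_powR a0 (powR_ge0 c (b - 1)) b0 q0 pq.
rewrite -powRrM [(b - 1) * _]mulrC divfK// => young.
have {young} : b * (a * c `^ (b - 1)) <= a `^ b + (b - 1) * c `^ b.
  rewrite (le_trans (ler_wpM2l (ltW b0) young))// le_eqVlt; apply/orP; left.
  by apply/eqP; field; rewrite bn0 b1n0.
have -> : b * c `^ (b - 1) * (a - c)
    = b * (a * c `^ (b - 1)) - b * (c * c `^ (b - 1)) by ring.
by rewrite cb; lra.
Qed.

Section homogeneous_subgradient.
Context (R : realType) (X : normedModType R) (J : X -> \bar R).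
Hypothesis J_homogeneous : absolutely_one_homogeneous J.
Variables (w : X) (j : R) (p : dual X).
Hypotheses (Jw : J w = j%:E) (pw : subdifferential J w p).

(** The subgradient inequality at 0 gives j <= p w, at 2 w it gives
    p w <= j. *)
Lemma homogeneous_subgradient_eq : p w = j.
Proof.
have J0 : J 0 = 0%E by rewrite -(scale0r 0) J_homogeneous normr0 mul0e.
have := pw 0; rewrite Jw J0 sub0r linearN -EFinD lee_fin subr_le0 => jp.
have := pw (2 *: w); rewrite J_homogeneous Jw scaler_nat mulr2n addrK.
rewrite ger0_norm ?ler0n// -EFinD -EFinM lee_fin => pj.
by apply/eqP; rewrite eq_le jp andbT; lra.
Qed.

Lemma homogeneous_subgradient_le v : ((p v)%:E <= J v)%E.
Proof.
have := pw v.
by rewrite Jw linearB /= homogeneous_subgradient_eq -EFinD subrKC.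
Qed.

End homogeneous_subgradient.

Section exact_penalty.
Context (R : realType) (X : normedModType R) (H : hilbertType R).
Variables (A : bounded_operator X H) (J : X -> \bar R) (f : H).
Hypothesis J_ge0 : forall u, (0 <= J u)%E.
Hypothesis J_homogeneous : absolutely_one_homogeneous J.
Variables (w : X) (j : R) (q : H).
Hypotheses (Jw : J w = j%:E) (Aw : A w = f).
Hypothesis qw : subdifferential J w (adjoint A q).

(** The functional v |-> <q, A v> lies below [J], is constant on A v = f, and
    touches [J] at [w], so [w] is a minimizer of [J] under the constraint. *)
Lemma source_J_min : J_min A J f = j%:E.
Proof.
have w_min : minimizers [set u | A u = f] J w.
  split=> // v Av; rewrite Jw -(homogeneous_subgradient_eq J_homogeneous Jw qw).
  have -> : adjoint A q w = adjoint A q v by rewrite /= Aw Av.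
  exact: (homogeneous_subgradient_le J_homogeneous Jw qw).
have [Ag g_min] := getPex (ex_intro _ w w_min).
by rewrite /J_min -Jw; apply/le_anti; rewrite g_min//= w_min.2.
Qed.

(** Write <q, A v> as <q, f> + <q, A v - f>, where <q, f> is [j], and bound
    the last term by Cauchy-Schwarz. *)
Lemma source_lower_bound v x : J v = x%:E -> j - `|q| * `|A v - f| <= x.
Proof.
move=> Jv.
have := homogeneous_subgradient_le J_homogeneous Jw qw v; rewrite Jv lee_fin.
apply: le_trans; rewrite -(homogeneous_subgradient_eq J_homogeneous Jw qw) /=.
rewrite lerBlDr -lerBlDl -linearBr /= Aw (le_trans (ler_norm _))//.
by rewrite (le_trans (inner_cauchy_schwarz _ _))// distrC.
Qed.

(** Compare energies with [w]: a nonzero residual r costs r, while the penalty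
    term of [u] falls short of that of [w] by at most
    t j ^ (beta - 1) |q| r < r. *)
Lemma exact_penalization (beta t : R) u :
  0 < j -> 1 <= beta -> 0 < t -> t * j `^ (beta - 1) * `|q| < 1 ->
  minimizers setT (energy A J 1 beta t f) u -> A u = f.
Proof.
move=> j0 b1 t0 tq [_ /(_ w I)]; have b0 : 0 < beta by lra.
have tb0 : 0 < t / beta by rewrite divr_gt0.
rewrite /energy Aw subrr normr0 powR0 ?oner_eq0// mulr0 add0e Jw invr1 mul1r.
rewrite powRr1// poweR_EFin -EFinM.
case Ju: (J u) => [x| |]; last by have := J_ge0 u; rewrite Ju.
  have x0 : 0 <= x by have := J_ge0 u; rewrite Ju lee_fin.
  rewrite poweR_EFin -EFinM -EFinD lee_fin => Euw.
  apply/eqP; rewrite -subr_eq0 -normr_eq0.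
  case: ltgtP (normr_ge0 (A u - f)) => // r0 _; exfalso.
  have lower := source_lower_bound Ju.
  have slope0 : 0 <= t * j `^ (beta - 1).
    by rewrite mulr_ge0 ?powR_ge0// ltW.
  have tangent : t / beta * j `^ beta + t * j `^ (beta - 1) * (x - j)
      <= t / beta * x `^ beta.
    rewrite (le_trans _ (ler_wpM2l (ltW tb0) (powR_ge_tangent b1 x0 j0)))//.
    by rewrite le_eqVlt; apply/orP; left; apply/eqP; field; rewrite gt_eqF.
  have drop : - (t * j `^ (beta - 1) * `|q|) * `|A u - f|
      <= t * j `^ (beta - 1) * (x - j).
    by rewrite -mulNr mulrAC -mulrA mulNr -mulrN ler_wpM2l//; lra.
  have := ltr_pM2r r0 (t * j `^ (beta - 1) * `|q|) 1.
  by rewrite tq; lra.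
by rewrite poweRyr ?gt_eqF// gt0_muley ?lte_fin// addey// leye_eq.
Qed.

End exact_penalty.

Theorem theorem2p11 (R : realType) (Y : completeNormedModType R)
    (H : hilbertType R) (A : bounded_operator (dual Y) H)
    (J : dual Y -> \bar R) (f : H) (beta : R)
    (Y_separable : separable Y)
    (J_ge0 : forall u, (0 <= J u)%E)
    (J_convex : convex_efun J)
    (J_proper : dom J !=set0)
    (J_lsc : weak_star_lsc J)
    (J_homogeneous : absolutely_one_homogeneous J)
    (f_J : forall u, A u = f -> J u != 0%E)
    (A_norm : norm_on (null_space J) (fun u => `|A u|))
    (A_norm_equivalent :
      equivalent_on (null_space J) (fun u => `|A u|) (fun u => `|u|))
    (A_coercive : exists2 C : R, 0 < C &
      forall u, ((`|u - null_projection A J (A u)|)%:E <= C%:E * J u)%E)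
    (A_weak_star_weak : forall (u_ : nat -> dual Y) (u : dual Y),
      weak_star_cvg u_ u -> weak_cvg (fun k => A (u_ k)) (A u))
    (beta_ge1 : 1 <= beta)
    (source_condition : exists2 u, dom J u &
      A u = f /\ exists q, subdifferential J u (adjoint A q)) :
  forall t, 0 < t -> t < t_star A J beta f ->
  forall u, minimizers setT (energy A J 1 beta t f) u -> A u = f.
Proof.
move=> t t0 tt u u_min.
have [u0 u0_dom [Au0 [q0 q0_sub]]] := source_condition.
set S := [set `|q| | q in [set q : H | exists u,
  [/\ dom J u, A u = f & subdifferential J u (adjoint A q)]]].
have S0 : S !=set0 by exists `|q0|, q0 => //; exists u0.
have s_ge0 : 0 <= s_star A J f.
  by apply: lb_le_inf => // _ [q _ <-]; exact: normr_ge0.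
have finite w : dom J w -> A w = f -> exists2 j, 0 < j & J w = j%:E.
  rewrite /dom /= => w_dom Aw; have := J_ge0 w; have := f_J w Aw.
  move: w_dom; case: (J w) => // j _ jn0; rewrite lee_fin => j0.
  by exists j => //; rewrite lt_neqAle j0 andbT eq_sym.
have [j j0 Ju0] := finite _ u0_dom Au0.
have Jmin := source_J_min J_homogeneous Ju0 Au0 q0_sub.
have s_lt : s_star A J f < j `^ (1 - beta) / t.
  move: tt; rewrite /t_star Jmin /= => tt.
  (* For s_star = 0 the quotient t_star is 0 by convention, but then the bound
     to prove is just positivity. *)
  move: s_ge0; rewrite le_eqVlt => /predU1P[s0|s0].
    by rewrite -s0 divr_gt0// powR_gt0.
  by rewrite ltr_pdivlMr// mulrC -ltr_pdivlMr.
have [_ [q [w [w_dom Aw qw] <-]] q_lt] := inf_lt S0 s_lt.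
have [k _ Jw] := finite _ w_dom Aw.
have kj : k = j.
  by have := source_J_min J_homogeneous Jw Aw qw; rewrite Jmin => -[].
rewrite {}kj in Jw.
apply: (exact_penalization J_ge0 J_homogeneous Jw Aw qw) u_min => //.
move: q_lt; rewrite ltr_pdivlMr// -opprB powRN => q_lt.
have d0 : 0 < j `^ (beta - 1) by rewrite powR_gt0.
by rewrite mulrAC -ltr_pdivlMr// mul1r mulrC.
Qed.
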